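(* Let $(M^{2n+1},\phi,\xi,\eta,g)$ be a contact metric manifold with contact distribution $\mathcal D=\ker\eta$ and Levi Civita connection $\hat\nabla$, and let $\tilde\nabla$ be the connection on $M^{2n+1}$ defined by $$\tilde\nabla_ZZ'=(\hat\nabla_ZZ')_{\mathcal D},\qquad \tilde\nabla_\xi Z=[\xi,Z],\qquad \tilde\nabla\xi=0\qquad (Z,Z'\in\Gamma(\mathcal D)).$$ Then $\tilde\nabla$ is the unique connection on $M^{2n+1}$ satisfying the following properties: (i) $\tilde\nabla\xi=0$; (ii) its torsion satisfies $\tilde T(V,W)=2d\eta(V,W)\xi$ for all $V,W\in\Gamma(TM^{2n+1})$; (iii) $(\tilde\nabla_Zg)(Z',Z'')=0$ for all $Z,Z',Z''\in\Gamma(\mathcal D)$. Furthermore, $M^{2n+1}$ is K-contact if and only if $\tilde\nabla g=0$, and $M^{2n+1}$ is Sasakian if and only if $\tilde\nabla\phi=0$, and in this case $\tilde\nabla$ coincides with the Tanaka-Webster connection of $(M^{2n+1},\phi,\xi,\eta,g)$.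
   Context: All manifolds are smooth and connected; $\Gamma(\cdot)$ denotes smooth sections. Convention: $2d\eta(V,W)=V(\eta(W))-W(\eta(V))-\eta([V,W])$. A contact form on $M^{2n+1}$ is a 1-form $\eta$ with $\eta\wedge(d\eta)^n\neq0$ everywhere; its Reeb vector field $\xi$ is determined by $\eta(\xi)=1$, $d\eta(\xi,\cdot)=0$. A contact metric structure $(\phi,\xi,\eta,g)$ consists of a contact form $\eta$ with Reeb field $\xi$, a Riemannian metric $g$ with $g(V,\xi)=\eta(V)$ and a $(1,1)$-tensor $\phi$ with $\phi^2=-I+\eta\otimes\xi$ and $d\eta(V,W)=g(V,\phi W)$. Set $h=\frac12\mathcal L_\xi\phi$. The manifold is K-contact if $\xi$ is Killing (equivalently $h=0$), and Sasakian if $[\phi,\phi]+2d\eta\otimes\xi=0$, equivalently $(\hat\nabla_V\phi)W=g(V,W)\xi-\eta(W)V$ for all $V,W$. The subscript $\mathcal D$ denotes projection along $TM=\mathcal D\oplus\mathbb R\xi$. The (generalized) Tanaka-Webster connection is $^{\ast}\nabla_VW=\hat\nabla_VW+\eta(V)\phi W+\eta(W)(\phi V+\phi hV)+d\eta(V+hV,W)\xi$.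
   Formalization: Uniqueness is proved among connections that preserve D (∇_V Z ∈ Γ(D) for Z ∈ Γ(D)), which ∇~ does; without this it fails for n ≥ 1, since ∇~_V W + g(V_D, W_D)ξ also satisfies (i)–(iii). *)

(* Defs.v *)
From HB Require Import structures.
From mathcomp Require Import all_boot all_order all_algebra all_fingroup.
From mathcomp Require Import all_classical all_reals topology normedtype derive.

Set Implicit Arguments.
Unset Strict Implicit.
Unset Printing Implicit Defensive.
Import Order.TTheory GRing.Theory Num.Theory.
Import numFieldNormedType.Exports.
Local Open Scope classical_set_scope.
Local Open Scope ring_scope.

Section SmoothOn.
Variables (R : realType) (d : nat).
Implicit Types (U : set 'rV[R]_d) (f g : 'rV[R]_d -> R).

Definition basis_vec (i : 'I_d) : 'rV[R]_d := delta_mx ord0 i.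

Fixpoint Ck (k : nat) U f : Prop :=
  (forall x, U x -> {for x, continuous f}) /\
  if k is k'.+1 then
    forall i : 'I_d, (forall x, U x -> derivable f x (basis_vec i)) /\
                     Ck k' U (fun x => 'D_(basis_vec i) f x)
  else True.

Definition smooth_on U f := forall k, Ck k U f.

Lemma Ck_ext k U f g : open U -> (forall x, U x -> f x = g x) ->
  Ck k U f -> Ck k U g.
Proof.
move=> oU.
have near_fg f' g' x : (forall y, U y -> f' y = g' y) -> U x ->
    \forall y \near x, f' y = g' y.
  move=> fg Ux; near=> y; apply: fg; near: y; exact: open_nbhs_nbhs.
have cont f' g' : (forall y, U y -> f' y = g' y) ->
    (forall x, U x -> {for x, continuous f'}) ->
    forall x, U x -> {for x, continuous g'}.
  move=> fg cf x Ux; have := cf x Ux.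
  rewrite /prop_for /continuous_at -(fg x Ux); apply: cvg_trans.
  by apply: (@near_eq_cvg _ _ (nbhs x)); apply: near_fg.
elim: k f g => [|k IH] f g fg [cf df]; split=> //; try exact: (cont _ _ fg cf).
move=> i; have [dfi Cfi] := df i; split=> [x Ux|].
  by apply: near_eq_derivable (dfi x Ux); apply: near_fg.
by apply: IH Cfi => x Ux; apply: near_eq_derive; apply: near_fg.
Unshelve. all: by end_near. Qed.

Lemma CkS k U f : Ck k.+1 U f -> Ck k U f.
Proof.
elim: k f => [|k IH] f [cf df]; first by split.
by split=> // i; have [? ?] := df i; split=> //; exact: IH.
Qed.

Lemma Ck_cst k U (a : R) : open U -> Ck k U (cst a).
Proof.
move=> oU; elim: k a => [|k IH] a; split=> //.
- by move=> x _; apply: cst_continuous.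
- by move=> x _; apply: cst_continuous.
- move=> i; split=> [x _|]; first exact: derivable_cst.
  apply: Ck_ext (IH 0) => // x _.
  by rewrite derive_cst.
Qed.

Lemma CkB k U f g : open U -> Ck k U f -> Ck k U g -> Ck k U (f - g).
Proof.
move=> oU; elim: k f g => [|k IH] f g [cf df] [cg dg]; split=> //.
- by move=> x Ux; apply: continuousB; [exact: cf|exact: cg].
- by move=> x Ux; apply: continuousB; [exact: cf|exact: cg].
- move=> i; have [dfi Cfi] := df i; have [dgi Cgi] := dg i; split.
    by move=> x Ux; apply: derivableB; [exact: dfi|exact: dgi].
  apply: Ck_ext (IH _ _ Cfi Cgi) => // x Ux.
  by rewrite deriveB //; [exact: dfi|exact: dgi].
Qed.

Lemma CkD k U f g : open U -> Ck k U f -> Ck k U g -> Ck k U (f + g).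
Proof.
move=> oU Cf Cg; have -> : f + g = f - (cst 0 - g).
  by apply/funext => x; rewrite !fctE sub0r opprK.
by apply: CkB => //; apply: CkB => //; exact: Ck_cst.
Qed.

Lemma CkM k U f g : open U -> Ck k U f -> Ck k U g -> Ck k U (f * g).
Proof.
move=> oU; elim: k f g => [|k IH] f g Cf Cg.
  have [cf _] := Cf; have [cg _] := Cg; split=> // x Ux.
  by apply: continuousM; [exact: cf|exact: cg].
have [cf df] := Cf; have [cg dg] := Cg; split=> [x Ux|i].
  by apply: continuousM; [exact: cf|exact: cg].
have [dfi Cfi] := df i; have [dgi Cgi] := dg i; split.
  by move=> x Ux; apply: derivableM; [exact: dfi|exact: dgi].
apply: Ck_ext (CkD oU (IH _ _ (CkS Cf) Cgi) (IH _ _ (CkS Cg) Cfi)) => // x Ux.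
by rewrite deriveM //; [exact: dfi|exact: dgi].
Qed.

End SmoothOn.

Record chart (R : realType) (d : nat) (T : topologicalType) := Chart {
  chart_dom : set T;
  chart_map : T -> 'rV[R]_d;
  chart_inv : 'rV[R]_d -> T;
  chart_dom_open : open chart_dom;
  chart_cod_open : open (chart_map @` chart_dom);
  chart_mapK : forall x, chart_dom x -> chart_inv (chart_map x) = x;
  chart_map_cont : {within chart_dom, continuous chart_map};
  chart_inv_cont : {within chart_map @` chart_dom, continuous chart_inv} }.

(* The atlas need not be maximal: an atlas determines the smooth structure,
   and every notion below depends only on the smooth functions. *)
Record manifold (R : realType) (d : nat) := Manifold {
  carrier :> topologicalType;
  atlas : set (chart R d carrier);
  carrier_hausdorff : hausdorff_space carrier;
  carrier_second_countable : @second_countable carrier;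
  carrier_connected : connected [set: carrier];
  atlas_cover : forall x : carrier, exists2 c, atlas c & chart_dom c x;
  atlas_compat : forall c c', atlas c -> atlas c' -> forall j : 'I_d,
    smooth_on (chart_map c @` (chart_dom c `&` chart_dom c'))
              (fun x => chart_map c' (chart_inv c x) ord0 j) }.

Section SmoothFunctions.
Variables (R : realType) (d : nat) (M : manifold R d).

Definition smooth (f : M -> R) := forall c, atlas c ->
  smooth_on (chart_map c @` chart_dom c) (f \o chart_inv c).

Definition smooth_pred : {pred M -> R} := fun f => `[< smooth f >].

Lemma smooth_cst (a : R) : smooth (cst a).
Proof. by move=> c _ k; apply: Ck_cst; exact: chart_cod_open. Qed.

Lemma smooth_subring_closed : subring_closed smooth_pred.
Proof.
split=> [|f g|f g]; first exact/asboolP/smooth_cst.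
- move=> /asboolP sf /asboolP sg; apply/asboolP => c ac k.
  apply: (@CkB _ _ _ _ (f \o chart_inv c) (g \o chart_inv c));
    [exact: chart_cod_open|exact: sf|exact: sg].
- move=> /asboolP sf /asboolP sg; apply/asboolP => c ac k.
  apply: (@CkM _ _ _ _ (f \o chart_inv c) (g \o chart_inv c));
    [exact: chart_cod_open|exact: sf|exact: sg].
Qed.

HB.instance Definition _ :=
  GRing.isSubringClosed.Build _ smooth_pred smooth_subring_closed.

(* The algebra C^oo(M). *)
Record Cinf := MkCinf { Cinf_fun :> M -> R; _ : Cinf_fun \in smooth_pred }.

HB.instance Definition _ := [isSub for Cinf_fun].
HB.instance Definition _ := [Choice of Cinf by <:].
HB.instance Definition _ :=
  GRing.SubChoice_isSubComPzRing.Build _ _ Cinf smooth_subring_closed.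

Definition constf (a : R) : Cinf := MkCinf (asboolT (smooth_cst a)).

(* A vector field is an R-linear derivation of C^oo(M); its value at p is the
   tangent vector f |-> (X f)(p). *)
Record is_derivation (X : Cinf -> Cinf) : Prop := IsDerivation {
  derivation_linear : forall a f g, X (constf a * f + g) = constf a * X f + X g;
  derivation_leibniz : forall f g, X (f * g) = f * X g + g * X f }.

Definition derivation_pred : {pred Cinf -> Cinf^o} :=
  fun X => `[< is_derivation X >].

Lemma derivation_submod_closed : submod_closed derivation_pred.
Proof.
split=> [|h X Y /asboolP[Xl XM] /asboolP[Yl YM]].
  apply/asboolP; split=> [a f g|f g]; rewrite /GRing.zero /=.
    by rewrite mulr0 addr0.
  by rewrite !mulr0 addr0.
have E f : (h *: X + Y) f = h * X f + Y f by [].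
apply/asboolP; split=> [a f g|f g]; rewrite !E.
  by rewrite Xl Yl !mulrDr mulrCA addrACA.
by rewrite XM YM !mulrDr mulrCA (mulrCA h g) addrACA.
Qed.

HB.instance Definition _ :=
  GRing.isSubmodClosed.Build _ _ derivation_pred derivation_submod_closed.

Record vfield :=
  MkVfield { vfield_fun :> Cinf -> Cinf^o; _ : vfield_fun \in derivation_pred }.

HB.instance Definition _ := [isSub for vfield_fun].
HB.instance Definition _ := [Choice of vfield by <:].
HB.instance Definition _ := [SubChoice_isSubLmodule of vfield by <:].

Lemma vfieldP (X : vfield) : is_derivation X.
Proof. exact/asboolP/(valP X). Qed.

Lemma lie_subproof (X Y : vfield) :
  (fun f => X (Y f) - Y (X f)) \in derivation_pred.
Proof.
apply/asboolP; have [Xl XM] := vfieldP X; have [Yl YM] := vfieldP Y.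
have one : constf 1 = 1 by exact/val_inj.
have XD f g : X (f + g) = X f + X g by have := Xl 1 f g; rewrite one !mul1r.
have YD f g : Y (f + g) = Y f + Y g by have := Yl 1 f g; rewrite one !mul1r.
split=> [a f g|f g]; first by rewrite Yl Xl Xl Yl mulrBr opprD addrACA.
rewrite YM XM XD YD !XM !YM !mulrBr !opprD.
rewrite [LHS](AC ((2*2)*(2*2)) ((1*5)*(3*7)*(2*8)*(4*6)))%AC /=.
by rewrite [Y f * _]mulrC [Y g * _]mulrC !subrr !addr0.
Qed.

Definition lie (X Y : vfield) : vfield := MkVfield (lie_subproof X Y).

End SmoothFunctions.

Notation "[' X , Y ]" := (lie X Y) (at level 0, format "[' X ,  Y ]").

(* One-forms are C^oo(M)-linear maps {scalar vfield M}, (1,1)-tensor fields are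
   C^oo(M)-linear maps {linear vfield M -> vfield M}. *)
Section Tensors.
Variables (R : realType) (d : nat) (M : manifold R d).
Implicit Types (X Y Z V W : vfield M) (g : vfield M -> vfield M -> Cinf M)
  (eta : {scalar vfield M}) (phi : {linear vfield M -> vfield M})
  (nb : vfield M -> vfield M -> vfield M).

Definition half : Cinf M := constf M 2^-1.

(* Convention: 2 d eta (V, W) = V (eta W) - W (eta V) - eta [V, W]. *)
Definition dform eta V W : Cinf M :=
  half * (V (eta W) - W (eta V) - eta [' V, W]).

(* The tangent vector of X at p is nonzero. *)
Definition nonzero_at X (p : M) := exists f : Cinf M, X f p != 0.

Record riemannian g : Prop := Riemannian {
  riemannian_linear : forall V, scalar (g V);
  riemannian_sym : forall V W, g V W = g W V;
  riemannian_pos : forall V p, nonzero_at V p -> 0 < g V V p }.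

Record connection nb : Prop := Connection {
  connection_linear : forall W, linear (nb^~ W);
  connection_add : forall V W W', nb V (W + W') = nb V W + nb V W';
  connection_leibniz : forall V f W, nb V (f *: W) = V f *: W + f *: nb V W }.

Definition torsion nb V W := nb V W - nb W V - [' V, W].

(* (nabla_V g)(W, W') *)
Definition cov_metric nb g V W W' :=
  V (g W W') - g (nb V W) W' - g W (nb V W').

(* (nabla_V phi) W *)
Definition cov_endo nb phi V W := nb V (phi W) - phi (nb V W).

Record levi_civita g nb : Prop := LeviCivita {
  levi_civita_connection : connection nb;
  levi_civita_torsion : forall V W, torsion nb V W = 0;
  levi_civita_metric : forall V W W', cov_metric nb g V W W' = 0 }.

Definition lie_metric X g V W := X (g V W) - g [' X, V] W - g V [' X, W].

Definition killing g X := forall V W, lie_metric X g V W = 0.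

Definition lie_endo X phi V := [' X, phi V] - phi [' X, V].

Definition nijenhuis phi V W :=
  phi (phi [' V, W]) + [' phi V, phi W] - phi [' phi V, W] - phi [' V, phi W].

End Tensors.

Section ContactMetric.
Variables (R : realType) (n : nat) (M : manifold R n.*2.+1).
Implicit Types (V W Z : vfield M) (nb : vfield M -> vfield M -> vfield M).
Variables (eta : {scalar vfield M}) (xi : vfield M)
  (phi : {linear vfield M -> vfield M}) (g : vfield M -> vfield M -> Cinf M).

(* The (2n+1)-form eta /\ (d eta)^n evaluated on X_0, ..., X_2n; as for dform,
   the wedge product is the antisymmetrisation with the factor 1/(2n+1)!. *)
Definition eta_deta_n (X : 'I_n.*2.+1 -> vfield M) : Cinf M :=
  constf M (n.*2.+1)`!%:R^-1 * \sum_(s : 'S_n.*2.+1) (-1) ^+ s *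
    (eta (X (s ord0)) *
     \prod_(i < n) dform eta (X (s (inord i.*2.+1))) (X (s (inord i.*2.+2)))).

Definition contact_form := forall p : M, exists X, eta_deta_n X p != 0.

Record contact_metric : Prop := ContactMetric {
  contact_metric_contact : contact_form;
  reeb_eta : eta xi = 1;
  reeb_deta : forall V, dform eta xi V = 0;
  contact_metric_riemannian : riemannian g;
  contact_metric_dual : forall V, g V xi = eta V;
  contact_metric_phi2 : forall V, phi (phi V) = - V + eta V *: xi;
  contact_metric_compat : forall V W, dform eta V W = g V (phi W) }.

(* Gamma(D), where D = ker eta *)
Definition horizontal V := eta V = 0.

Definition projD V := V - eta V *: xi.

Definition h_tensor V := half M *: lie_endo xi phi V.

Definition K_contact := killing g xi.

Definition sasakian :=
  forall V W, nijenhuis phi V W + (2 * dform eta V W) *: xi = 0.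

Definition tanaka_webster nb V W :=
  nb V W + eta V *: phi W + eta W *: (phi V + phi (h_tensor V))
  + dform eta (V + h_tensor V) W *: xi.

Record tilde_equations nb nbt : Prop := TildeEquations {
  tilde_horizontal : forall Z Z', horizontal Z -> horizontal Z' ->
    nbt Z Z' = projD (nb Z Z');
  tilde_reeb : forall Z, horizontal Z -> nbt xi Z = [' xi, Z];
  tilde_parallel_reeb : forall V, nbt V xi = 0 }.

Record tilde_properties nbt : Prop := TildeProperties {
  prop_parallel_reeb : forall V, nbt V xi = 0;
  prop_torsion : forall V W, torsion nbt V W = (2 * dform eta V W) *: xi;
  prop_metric : forall Z Z' Z'',
    horizontal Z -> horizontal Z' -> horizontal Z'' ->
    cov_metric nbt g Z Z' Z'' = 0 }.

(* A connection on TM = D + R xi respecting D.  The three properties above do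
   not control the xi-component of nbt on D: if nbt satisfies them, so does
   (V, W) |-> nbt V W + g (projD V) (projD W) *: xi.  Uniqueness therefore holds
   among the connections respecting D. *)
Definition preserves_D nbt :=
  forall V Z, horizontal Z -> horizontal (nbt V Z).

End ContactMetric.

(* Main.v *)
Require Import Defs.
From mathcomp Require Import all_boot all_order all_algebra all_fingroup.
From mathcomp Require Import all_classical all_reals topology normedtype derive.
From mathcomp Require Import ring.
Set Implicit Arguments.
Unset Strict Implicit.
Unset Printing Implicit Defensive.
Import Order.TTheory GRing.Theory Num.Theory.
Local Open Scope ring_scope.

(** The proof is a computation in the module of vector fields over the ring of
    smooth functions; points enter only through the positivity of [g], which
    makes [g] definite on that module.

    A connection along which [xi] is parallel is determined by its restriction
    to pairs of horizontal fields and by [V |-> nabla_xi V]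
    ([parallel_reeb_split]).  The defining equations prescribe both, so they
    have exactly one solution, and that solution has the torsion [2 d eta (x)
    xi] and is metric along [ker eta] ([tilde_equations_adapted]).  Conversely,
    the torsion condition forces [nabla_xi V = [xi, V]], and on horizontal
    fields the difference of two candidates is symmetric in two of its three
    arguments and skew in two, hence zero ([adapted_unique]).

    In the direction of [xi] the connection is the Lie derivative, in horizontal
    directions it is metric; so [nabla g = eta (x) L_xi g], which vanishes if
    and only if [xi] is Killing ([adapted_cov_metric]).

    For the Sasakian part put [B X Y = (nabla_X phi) Y].  Rewriting the brackets
    in the Nijenhuis tensor through the connection, the torsion accounts exactly
    for the [2 d eta (x) xi] in the normality condition, which thus becomes
    [B (phi X) Y - B (phi Y) X - phi (B X Y) + phi (B Y X) = 0]
    ([nijenhuis_adapted]).  If [B = 0] this holds.  Conversely it gives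
    [B xi = 0], and on horizontal fields the argument is the one by which an
    integrable almost Kaehler structure is Kaehler: [g (B X Y) Z] is, up to
    sign, the covariant derivative of [d eta], so its cyclic sum vanishes, and
    together with the normality condition this forces it to vanish
    ([sasakian_cov_phi]).

    A Sasakian structure has [L_xi phi = 0], hence [h = 0] and [L_xi g = 0], so
    [nabla^_V xi = - phi V] for the Levi-Civita connection.  With these two
    facts the Tanaka-Webster connection visibly solves the defining equations
    of [tilde nabla] ([tanaka_webster_tilde]), and uniqueness identifies the
    two. *)

(** * Calculus of functions, vector fields and one-forms *)

Section VectorFields.
Context {R : realType} {d : nat} {M : manifold R d}.
Implicit Types (X Y Z V W : vfield M) (a b f : Cinf M)
  (eta : {scalar vfield M}).

Lemma vfield_ext X Y : (forall f, X f = Y f) -> X = Y.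
Proof. by move=> XY; apply/val_inj/funext. Qed.

Lemma vfieldDE X Y f : (X + Y) f = X f + Y f :> Cinf M. Proof. by []. Qed.
Lemma vfieldNE X f : (- X) f = - X f :> Cinf M. Proof. by []. Qed.
Lemma vfieldZE a X f : (a *: X) f = a * X f :> Cinf M. Proof. by []. Qed.
Lemma vfield0E f : (0 : vfield M) f = 0 :> Cinf M. Proof. by []. Qed.
Lemma lieE X Y f : [' X, Y] f = X (Y f) - Y (X f) :> Cinf M. Proof. by []. Qed.
Definition vfieldE := (vfieldDE, vfieldNE, vfieldZE, vfield0E, lieE).

Lemma constf1 : constf M 1 = 1. Proof. exact/val_inj. Qed.

Lemma vderivD X a b : X (a + b) = X a + X b :> Cinf M.
Proof.
by have := derivation_linear (vfieldP X) 1 a b; rewrite constf1 !mul1r.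
Qed.

Lemma vderivM X a b : X (a * b) = a * X b + b * X a :> Cinf M.
Proof. exact: derivation_leibniz (vfieldP X) a b. Qed.

Lemma vderiv0 X : X 0 = 0 :> Cinf M.
Proof. by apply: (addrI (X 0)); rewrite -vderivD !addr0. Qed.

Lemma vderivN X a : X (- a) = - X a :> Cinf M.
Proof. by apply: (addrI (X a)); rewrite -vderivD !subrr vderiv0. Qed.

Lemma vderiv1 X : X 1 = 0 :> Cinf M.
Proof.
apply: (addrI (X 1)); rewrite addr0 -{3}[1]mulr1 vderivM.
by rewrite !mul1r.
Qed.

Definition vderivE := (vderivD, vderivM, vderiv0, vderivN, vderiv1).

Lemma lieC X Y : [' X, Y] = - [' Y, X].
Proof. by apply: vfield_ext => f; rewrite !vfieldE; ring. Qed.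

Lemma lieDr X Y Z : [' X, Y + Z] = [' X, Y] + [' X, Z].
Proof. by apply: vfield_ext => f; rewrite !(vfieldE, vderivE); ring. Qed.

Lemma lieDl X Y Z : [' X + Y, Z] = [' X, Z] + [' Y, Z].
Proof. by apply: vfield_ext => f; rewrite !(vfieldE, vderivE); ring. Qed.

Lemma lieZr X a Y : [' X, a *: Y] = X a *: Y + a *: [' X, Y].
Proof. by apply: vfield_ext => f; rewrite !(vfieldE, vderivE); ring. Qed.

Lemma lieZl a X Y : [' a *: X, Y] = a *: [' X, Y] - Y a *: X.
Proof. by apply: vfield_ext => f; rewrite !(vfieldE, vderivE); ring. Qed.

Lemma liexx X : [' X, X] = 0.
Proof. by apply: vfield_ext => f; rewrite !vfieldE subrr. Qed.

Lemma lie0r X : [' X, 0] = 0.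
Proof. by apply: vfield_ext => f; rewrite !vfieldE vderiv0 subrr. Qed.

Lemma jacobi X Y Z :
  [' [' X, Y], Z] + [' [' Y, Z], X] + [' [' Z, X], Y] = 0.
Proof. by apply: vfield_ext => f; rewrite !(vfieldE, vderivE); ring. Qed.

Lemma oneformD eta V W : eta (V + W) = eta V + eta W.
Proof. exact: linearD. Qed.

Lemma oneformZ eta a V : eta (a *: V) = a * eta V.
Proof. exact: scalarZ. Qed.

Lemma oneformN eta V : eta (- V) = - eta V.
Proof. exact: linearN. Qed.

Lemma oneform0 eta : eta 0 = 0.
Proof. exact: linear0. Qed.

Definition oneformE := (oneformD, oneformZ, oneformN, oneform0).

Lemma two_half : 2 * Defs.half M = 1.
Proof.
rewrite mulrDl mul1r; apply/val_inj/funext => p.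
rewrite -[LHS]/(2^-1 + 2^-1 : R) -[RHS]/(1 : R).
by rewrite -[X in X + X]mul1r -splitr.
Qed.

Lemma two_mul_inj a b : 2 * a = 2 * b -> a = b.
Proof.
move=> ab; rewrite -[a]mul1r -[b]mul1r -two_half.
by rewrite ![2 * _]mulrC -!mulrA ab.
Qed.

Lemma double_dform eta V W :
  2 * dform eta V W = V (eta W) - W (eta V) - eta [' V, W].
Proof. by rewrite /dform mulrA two_half mul1r. Qed.

Lemma dformC eta V W : dform eta V W = - dform eta W V.
Proof.
by apply: two_mul_inj; rewrite mulrN !double_dform lieC oneformN; ring.
Qed.

(** This is [d (d eta) = 0]; it comes down to the Jacobi identity. *)
Lemma dform_closed eta X Y Z :
  X (dform eta Y Z) + Y (dform eta Z X) + Z (dform eta X Y) =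
  dform eta [' X, Y] Z + dform eta [' Y, Z] X + dform eta [' Z, X] Y
  :> Cinf M.
Proof.
have twoX (U V W : vfield M) : 2 * U (dform eta V W) =
    U (V (eta W)) - U (W (eta V)) - U (eta [' V, W]) :> Cinf M.
  have := congr1 U (double_dform eta V W).
  by rewrite mulrDl mul1r !vderivD !vderivN mulrDl mul1r.
have := congr1 eta (jacobi X Y Z); rewrite !oneformE => J.
apply: two_mul_inj; rewrite !mulrDr !twoX !double_dform !lieE.
by apply/eqP; rewrite -subr_eq0 -[X in _ == X]J; apply/eqP; ring.
Qed.

End VectorFields.

(** Identities in the module of vector fields hold as soon as they hold after
    evaluation at every function, where they become identities of a
    commutative ring.  The evaluations are unfolded syntactically, because
    matching up to conversion would open the Lie brackets. *)
Ltac vfield_eval :=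
  let step C e :=
    match type of e with _ = ?r => let G := context C [r] in change G end in
  match goal with
  | |- context C [vfield_fun (@Algebra.add _ ?X ?Y) ?f] =>
    let e := constr:(vfieldDE X Y f) in step C e
  | |- context C [vfield_fun (@Algebra.opp _ ?X) ?f] =>
    let e := constr:(vfieldNE X f) in step C e
  | |- context C [vfield_fun (@GRing.scale _ _ ?a ?X) ?f] =>
    let e := constr:(vfieldZE a X f) in step C e
  | |- context C [vfield_fun (@Algebra.zero _) ?f] =>
    let e := constr:(vfield0E f) in step C e
  end.

Ltac vfield_ring := apply: vfield_ext => ?; repeat vfield_eval; ring.

(** * Metrics and connections *)

Section Metric.
Context {R : realType} {d : nat} {M : manifold R d}.
Context (g : vfield M -> vfield M -> Cinf M) (Hg : riemannian g).
Implicit Types (V W X : vfield M) (a : Cinf M).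

Lemma metricC V W : g V W = g W V. Proof. exact: riemannian_sym. Qed.

Lemma metricDr V W X : g V (W + X) = g V W + g V X.
Proof. by have := riemannian_linear Hg V 1 W X; rewrite scale1r mul1r. Qed.

Lemma metric0r V : g V 0 = 0.
Proof. by apply: (addrI (g V 0)); rewrite -metricDr !addr0. Qed.

Lemma metricZr V a W : g V (a *: W) = a * g V W.
Proof. by have := riemannian_linear Hg V a W 0; rewrite metric0r !addr0. Qed.

Lemma metricNr V W : g V (- W) = - g V W.
Proof. by rewrite -scaleN1r metricZr mulN1r. Qed.

Lemma metricDl V W X : g (V + W) X = g V X + g W X.
Proof. by rewrite !(metricC _ X) metricDr. Qed.

Lemma metricZl a V W : g (a *: V) W = a * g V W.
Proof. by rewrite !(metricC _ W) metricZr. Qed.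

Lemma metricNl V W : g (- V) W = - g V W.
Proof. by rewrite !(metricC _ W) metricNr. Qed.

Lemma metric0l V : g 0 V = 0.
Proof. by rewrite metricC metric0r. Qed.

Definition metricE := (metricDr, metricZr, metricNr, metric0r,
                       metricDl, metricZl, metricNl, metric0l).

(** At a point where [V] does not vanish, positivity gives [g V V > 0]. *)
Lemma metric_definite V : g V V = 0 -> V = 0.
Proof.
move=> gV0; apply: vfield_ext => f; apply/val_inj/funext => p.
apply/eqP/negP => /negP Vfp.
by have := riemannian_pos Hg (ex_intro _ f Vfp); rewrite gV0 ltxx.
Qed.

Lemma metric_nondegenerate V : (forall W, g V W = 0) -> V = 0.
Proof. by move=> gV0; apply: metric_definite. Qed.

End Metric.

Section Connection.
Context {R : realType} {d : nat} {M : manifold R d}.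
Context (nb : vfield M -> vfield M -> vfield M) (Hnb : connection nb).
Implicit Types (U V W X : vfield M) (a : Cinf M).

Lemma connDr V W X : nb V (W + X) = nb V W + nb V X.
Proof. exact: connection_add. Qed.

Lemma connZr V a W : nb V (a *: W) = V a *: W + a *: nb V W.
Proof. exact: connection_leibniz. Qed.

Lemma conn0r V : nb V 0 = 0.
Proof. by apply: (addrI (nb V 0)); rewrite -connDr !addr0. Qed.

Lemma connNr V W : nb V (- W) = - nb V W.
Proof. by apply: (addrI (nb V W)); rewrite -connDr !subrr conn0r. Qed.

Lemma connDl V W X : nb (V + W) X = nb V X + nb W X.
Proof. by have := connection_linear Hnb X 1 V W; rewrite !scale1r. Qed.

Lemma conn0l V : nb 0 V = 0.
Proof. by apply: (addrI (nb 0 V)); rewrite -connDl !addr0. Qed.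

Lemma connZl a V W : nb (a *: V) W = a *: nb V W.
Proof. by have := connection_linear Hnb W a V 0; rewrite conn0l !addr0. Qed.

Lemma connNl V W : nb (- V) W = - nb V W.
Proof. by apply: (addrI (nb V W)); rewrite -connDl !subrr conn0l. Qed.

Definition connE := (connDr, connZr, connNr, conn0r,
                     connDl, connZl, connNl, conn0l).

Lemma cov_endo_linear_l (phi : {linear vfield M -> vfield M}) W :
  linear (fun V => cov_endo nb phi V W).
Proof.
move=> a V V'; rewrite /cov_endo !connE linearD linearZ /=.
by rewrite scalerBr opprD addrACA.
Qed.

Lemma cov_endo_linear_r (phi : {linear vfield M -> vfield M}) V :
  linear (cov_endo nb phi V).
Proof.
move=> a W W'; rewrite /cov_endo linearD linearZ /= !connE !linearD !linearZ /=.
vfield_ring.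
Qed.

Context (g : vfield M -> vfield M -> Cinf M) (Hg : riemannian g).

Lemma cov_metricC V W W' : cov_metric nb g V W W' = cov_metric nb g V W' W.
Proof.
by rewrite /cov_metric !(metricC Hg W') (metricC Hg _ (nb V W')); ring.
Qed.

Lemma cov_metric_linear_l W W' : scalar (fun V => cov_metric nb g V W W').
Proof.
by move=> a V V'; rewrite /cov_metric !vfieldE !connE !(metricE Hg); ring.
Qed.

Lemma cov_metric_linear_m V W' : scalar (fun W => cov_metric nb g V W W').
Proof.
move=> a W X; rewrite /cov_metric !connE !(metricE Hg) !vderivE; ring.
Qed.

Lemma cov_metric_linear_r V W : scalar (cov_metric nb g V W).
Proof.
by move=> a W' X; rewrite !(cov_metricC V W); exact: cov_metric_linear_m.
Qed.

End Connection.

(** * Connections with a parallel Reeb field *)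

Section Splitting.
Context {R : realType} {n : nat} {M : manifold R n.*2.+1}.
Context (eta : {scalar vfield M}) (xi : vfield M) (eta_xi : eta xi = 1).
Implicit Types (V W Z : vfield M) (nt : vfield M -> vfield M -> vfield M).

Notation P := (projD eta xi).

Lemma splitD V : V = P V + eta V *: xi.
Proof. by rewrite /projD subrK. Qed.

Lemma projD_horizontal V : horizontal eta (P V).
Proof. by rewrite /horizontal /projD !oneformE eta_xi mulr1 subrr. Qed.

Lemma projD_id Z : horizontal eta Z -> P Z = Z.
Proof. by move=> Z0; rewrite /projD Z0 scale0r subr0. Qed.

Lemma projD_reeb : P xi = 0.
Proof. by rewrite /projD eta_xi scale1r subrr. Qed.

Lemma projDD V W : P (V + W) = P V + P W.
Proof. rewrite /projD oneformD; vfield_ring. Qed.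

Lemma projDZ a V : P (a *: V) = a *: P V.
Proof. rewrite /projD oneformZ; vfield_ring. Qed.

(** The bracket splits like a parallel-Reeb connection does, which is what makes
    the torsion of [tilde_connection] computable. *)
Lemma lie_split V W :
  [' V, W] = [' P V, P W] + eta V *: [' xi, P W] - eta W *: [' xi, P V]
             + (V (eta W) - W (eta V)) *: xi.
Proof.
(* [V] and [W] are split only where they act as derivations. *)
rewrite {1 5}(splitD V) {1 6}(splitD W).
move: (P V) (P W) (eta V) (eta W) => A B a b.
rewrite lieDl !lieDr !lieZl !lieZr liexx (lieC A xi).
vfield_ring.
Qed.

(** Linearity in [V] and the Leibniz rule in [W] along
    [TM = ker eta + R xi] reduce such a connection to its values on pairs of
    horizontal fields.  This serves both uniqueness statements: the defining
    equations prescribe those values, the torsion and metric conditions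
    determine them. *)
Lemma parallel_reeb_split nt : connection nt -> (forall V, nt V xi = 0) ->
  (forall Z, horizontal eta Z -> nt xi Z = [' xi, Z]) ->
  forall V W, nt V W = nt (P V) (P W) + eta V *: [' xi, P W] + V (eta W) *: xi.
Proof.
move=> Hnt ntxi ntD V W.
rewrite {1}(splitD W) (connDr Hnt) (connZr Hnt) ntxi scaler0 addr0.
rewrite {1}(splitD V) (connDl Hnt) (connZl Hnt) ntD //.
exact: projD_horizontal.
Qed.

Lemma parallel_reeb_ext nt nt' :
  connection nt -> (forall V, nt V xi = 0) ->
  (forall Z, horizontal eta Z -> nt xi Z = [' xi, Z]) ->
  connection nt' -> (forall V, nt' V xi = 0) ->
  (forall Z, horizontal eta Z -> nt' xi Z = [' xi, Z]) ->
  (forall Z Z', horizontal eta Z -> horizontal eta Z' -> nt Z Z' = nt' Z Z') ->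
  nt = nt'.
Proof.
move=> c0 p0 r0 c1 p1 r1 E; apply/funext => V; apply/funext => W.
rewrite (parallel_reeb_split c0 p0 r0) (parallel_reeb_split c1 p1 r1).
by rewrite (E _ _ (projD_horizontal V) (projD_horizontal W)).
Qed.

Context (nabla : vfield M -> vfield M -> vfield M) (Hnabla : connection nabla).

Lemma tilde_equations_unique nt nt' :
  connection nt -> tilde_equations eta xi nabla nt ->
  connection nt' -> tilde_equations eta xi nabla nt' -> nt = nt'.
Proof.
move=> c [h r p] c' [h' r' p']; apply: parallel_reeb_ext => // Z Z' HZ HZ'.
by rewrite h ?h'.
Qed.

(** The only candidate, by [parallel_reeb_split]. *)
Definition tilde_connection V W : vfield M :=
  P (nabla (P V) (P W)) + eta V *: [' xi, P W] + V (eta W) *: xi.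

Lemma tilde_connection_connection : connection tilde_connection.
Proof.
split=> [W a V V'|V W W'|V f W]; rewrite /tilde_connection.
- rewrite projDD projDZ (connDl Hnabla) (connZl Hnabla) projDD projDZ.
  rewrite oneformD oneformZ.
  move: (P (nabla _ _)) (P (nabla _ _)) ['xi, _] (eta W) => A B C w.
  vfield_ring.
- rewrite projDD (connDr Hnabla) projDD oneformD vderivD lieDr.
  move: (P (nabla _ _)) (P (nabla _ _)) ['xi, _] ['xi, _] => A B C D.
  vfield_ring.
- rewrite projDZ (connZr Hnabla) projDD projDZ projDZ oneformZ vderivM lieZr.
  rewrite (projD_id (projD_horizontal W)).
  move: (P (nabla _ _)) ['xi, _] => A B.
  rewrite /projD; vfield_ring.
Qed.

Lemma tilde_connection_equations :
  tilde_equations eta xi nabla tilde_connection.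
Proof.
split=> [Z Z' HZ HZ'|Z HZ|V]; rewrite /tilde_connection.
- by rewrite (projD_id HZ) (projD_id HZ') HZ HZ' vderiv0 !scale0r !addr0.
- rewrite projD_reeb (conn0l Hnabla) (projD_id HZ) HZ vderiv0 eta_xi scale1r.
  by rewrite /projD oneform0 !scale0r oppr0 !add0r addr0.
- rewrite projD_reeb (conn0r Hnabla) lie0r eta_xi vderiv1 /projD linear0.
  by rewrite scaler0 !scale0r oppr0 !addr0.
Qed.

End Splitting.

(** * Contact metric identities *)

Section ContactMetricIdentities.
Context {R : realType} {n : nat} {M : manifold R n.*2.+1}.
Context (eta : {scalar vfield M}) (xi : vfield M)
  (phi : {linear vfield M -> vfield M}) (g : vfield M -> vfield M -> Cinf M)
  (Hcm : contact_metric eta xi phi g).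
Implicit Types (V W X Y Z : vfield M).

Let Hg := contact_metric_riemannian Hcm.
Let eta_xi := reeb_eta Hcm.
Let g_xi := contact_metric_dual Hcm.
Let compat := contact_metric_compat Hcm.

(** That is, [L_xi eta = 0]; in particular [xi] preserves [ker eta]. *)
Lemma eta_lie_reeb V : eta [' xi, V] = xi (eta V).
Proof.
have := double_dform eta xi V.
rewrite (reeb_deta Hcm) mulr0 eta_xi vderiv1 subr0 => /esym/eqP.
by rewrite subr_eq0 => /eqP.
Qed.

Lemma phi_reeb : phi xi = 0.
Proof.
apply: (metric_nondegenerate Hg) => V.
by rewrite (metricC Hg) -compat dformC (reeb_deta Hcm) oppr0.
Qed.

Lemma eta_phi V : eta (phi V) = 0.
Proof. by rewrite -g_xi (metricC Hg) -compat (reeb_deta Hcm). Qed.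

Lemma metric_phi_skew V W : g (phi V) W = - g V (phi W).
Proof. by rewrite (metricC Hg) -!compat dformC. Qed.

(** The metric is recovered from [eta], [d eta] and [phi]. *)
Lemma metric_dform V W : g V W = - dform eta V (phi W) + eta V * eta W.
Proof.
rewrite compat (contact_metric_phi2 Hcm) !(metricE Hg) g_xi.
by rewrite opprD opprK mulrC addrNK.
Qed.

Lemma dform_phi V W : dform eta (phi V) (phi W) = dform eta V W.
Proof.
rewrite !compat metric_phi_skew (contact_metric_phi2 Hcm) eta_phi.
by rewrite scale0r addr0 (metricNr Hg) opprK.
Qed.

Lemma dformDl V W X : dform eta (V + W) X = dform eta V X + dform eta W X.
Proof. by rewrite !compat (metricDl Hg). Qed.

Lemma phi_inj_horizontal Z : horizontal eta Z -> phi Z = 0 -> Z = 0.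
Proof.
move=> HZ pZ; have := contact_metric_phi2 Hcm Z.
by rewrite pZ linear0 HZ scale0r addr0 => /esym/eqP; rewrite oppr_eq0 => /eqP.
Qed.

(** Cartan's formula: [L_xi (d eta) = d (i_xi d eta) + i_xi (d (d eta)) = 0]. *)
Lemma dform_lie_reeb V W :
  xi (dform eta V W) = dform eta [' xi, V] W + dform eta V [' xi, W]
  :> Cinf M.
Proof.
have := dform_closed eta xi V W; rewrite (reeb_deta Hcm) (dformC eta W xi).
rewrite (reeb_deta Hcm) (dformC eta [' V, W]) (reeb_deta Hcm) oppr0.
rewrite !vderiv0 !addr0 => ->; rewrite (dformC eta V) (lieC xi W).
by rewrite !compat (metricNl Hg) opprK.
Qed.

End ContactMetricIdentities.

(** * Adapted connections *)

Section Adapted.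
Context {R : realType} {n : nat} {M : manifold R n.*2.+1}.
Context (eta : {scalar vfield M}) (xi : vfield M)
  (phi : {linear vfield M -> vfield M}) (g : vfield M -> vfield M -> Cinf M)
  (Hcm : contact_metric eta xi phi g).
Implicit Types (V W X Y Z : vfield M).

Let Hg := contact_metric_riemannian Hcm.
Let eta_xi := reeb_eta Hcm.
Let g_xi := contact_metric_dual Hcm.
Let compat := contact_metric_compat Hcm.
Notation P := (projD eta xi).

(** The characterisation of [tilde nabla] without reference to the Levi-Civita
    connection; the K-contact and Sasakian criteria follow from it alone. *)
Definition adapted nt :=
  [/\ connection nt, preserves_D eta nt & tilde_properties eta xi g nt].

Lemma eta_projD V : eta (P V) = 0.
Proof. exact: projD_horizontal. Qed.

Lemma tilde_equations_adapted nabla nt : levi_civita g nabla ->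
  connection nt -> tilde_equations eta xi nabla nt ->
  adapted nt.
Proof.
move=> [Hn Ht Hm] Hnt [h r p].
have split_nt := parallel_reeb_split eta_xi Hnt p r.
have split_nabla V W : nt V W =
    P (nabla (P V) (P W)) + eta V *: [' xi, P W] + V (eta W) *: xi.
  by rewrite split_nt h //; exact: eta_projD.
split=> [//|V Z HZ|].
  rewrite split_nabla /horizontal 2!oneformD 2!oneformZ.
  rewrite (eta_lie_reeb Hcm) !eta_projD.
  by rewrite HZ !vderiv0 mul0r mulr0 !addr0.
split=> [//|V W|Z Z' Z'' HZ HZ' HZ''].
- have nablaC : nabla (P V) (P W) = nabla (P W) (P V) + [' P V, P W].
    have/eqP := Ht (P V) (P W).
    by rewrite /torsion subr_eq0 subr_eq addrC => /eqP.
  rewrite /torsion !split_nabla nablaC projDD double_dform.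
  rewrite (lie_split eta xi V W) !oneformD oneformN !oneformZ.
  rewrite !(eta_lie_reeb Hcm) !eta_projD !vderiv0 (reeb_eta Hcm).
  move: (P _) ['xi, _] ['xi, _] ['P V, P W] => A B C D.
  rewrite /projD; vfield_ring.
- rewrite -(Hm Z Z' Z'') /cov_metric !h // /projD !(metricE Hg).
  by rewrite g_xi (metricC Hg xi) g_xi HZ' HZ''; ring.
Qed.

Lemma adapted_lie nt V W : adapted nt ->
  nt V W = nt W V + [' V, W] + (2 * dform eta V W) *: xi.
Proof.
move=> [_ _ [_ T _]]; rewrite -T /torsion.
by rewrite -[RHS]addrA [_ + (_ - _ - _)]addrC subrK addrC subrK.
Qed.

Lemma adapted_reeb nt V : adapted nt -> nt xi V = [' xi, V].
Proof.
move=> Hnt; have [_ _ [p _ _]] := Hnt.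
rewrite (adapted_lie _ _ Hnt) p (reeb_deta Hcm) mulr0 scale0r.
by rewrite add0r addr0.
Qed.

Lemma adapted_eta nt V W : adapted nt -> eta (nt V W) = V (eta W).
Proof.
move=> [c pD [p _ _]]; rewrite {1}(splitD eta xi W) (connDr c) (connZr c) p.
rewrite scaler0 addr0 oneformD oneformZ eta_xi mulr1.
by rewrite pD ?add0r //; exact: projD_horizontal.
Qed.

(** As for the Levi-Civita connection: on horizontal fields the difference of
    two adapted connections, lowered by [g], is symmetric in its first two
    arguments and skew in its last two, and such a trilinear form is zero. *)
Lemma adapted_unique nt nt' : adapted nt -> adapted nt' -> nt = nt'.
Proof.
move=> H H'; have [c pD [p T m]] := H; have [c' pD' [p' T' m']] := H'.
apply: (parallel_reeb_ext eta_xi c p _ c' p') => [Z _|Z _|];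
  try exact: adapted_reeb.
pose D Z Z' := nt Z Z' - nt' Z Z'.
have D_sym Z Z' : D Z Z' = D Z' Z.
  rewrite /D (adapted_lie Z Z' H) (adapted_lie Z Z' H').
  by move: (nt _ _) (nt' _ _) ['Z, Z'] => A B C; vfield_ring.
have D_skew X Y Z : horizontal eta X -> horizontal eta Y -> horizontal eta Z ->
    g (D X Y) Z = - g (D X Z) Y.
  move=> HX HY HZ; apply/eqP; rewrite -addr_eq0; apply/eqP.
  transitivity (cov_metric nt' g X Y Z - cov_metric nt g X Y Z); last first.
    by rewrite m // m' // subrr.
  rewrite /cov_metric /D !(metricDl Hg) !(metricNl Hg) !(metricC Hg Y).
  by move: (g _ _) => A; ring.
have D_horizontal X Y : horizontal eta X -> horizontal eta Y ->
    horizontal eta (D X Y).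
  by move=> HX HY; rewrite /horizontal oneformD oneformN pD // pD' // subrr.
move=> X Y HX HY; apply/eqP; rewrite -subr_eq0; apply/eqP.
(* Skewness and symmetry alternate six times and return the opposite sign. *)
have D0 Z : horizontal eta Z -> g (D X Y) Z = 0.
  move=> HZ; apply: two_mul_inj; rewrite mulr0 mulrDl mul1r.
  rewrite {1}D_skew // (D_sym X) D_skew // opprK (D_sym Z) D_skew //.
  by rewrite (D_sym Y) addNr.
by apply: (metric_definite Hg); apply/D0/D_horizontal.
Qed.

Section Fixed.
Context (nt : vfield M -> vfield M -> vfield M) (Hnt : adapted nt).

Let c : connection nt. Proof. by case: Hnt. Qed.
Let nt_xi V : nt V xi = 0. Proof. by case: Hnt => _ _ []. Qed.
Let nt_reeb V : nt xi V = [' xi, V]. Proof. exact: adapted_reeb. Qed.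
Let nt_eta V W : eta (nt V W) = V (eta W). Proof. exact: adapted_eta. Qed.

(** Only the direction [xi] is left uncontrolled by the metric condition, and
    there the adapted connection is the Lie derivative. *)
Lemma adapted_cov_metric V W W' :
  cov_metric nt g V W W' = eta V * lie_metric xi g W W'.
Proof.
have cov_xi U U' : cov_metric nt g U U' xi = 0.
  rewrite /cov_metric nt_xi (metric0r Hg) !g_xi nt_eta.
  by rewrite subr0 subrr.
have cov_P U U1 U2 : cov_metric nt g U U1 U2 = cov_metric nt g U (P U1) (P U2).
  rewrite {1}(splitD eta xi U1) {1}(splitD eta xi U2) ![_ + _ *: xi]addrC.
  rewrite (cov_metric_linear_r c Hg) cov_xi mulr0 add0r.
  rewrite (cov_metricC nt Hg) (cov_metric_linear_r c Hg) cov_xi mulr0 add0r.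
  exact: cov_metricC.
have cov_reeb U U' : cov_metric nt g xi U U' = lie_metric xi g U U'.
  by rewrite /cov_metric /lie_metric !nt_reeb.
rewrite {1}(splitD eta xi V) addrC (cov_metric_linear_l c Hg) cov_reeb cov_P.
have [_ _ [_ _ ->]] := Hnt; rewrite ?addr0 //; exact: projD_horizontal.
Qed.

Lemma adapted_K_contact :
  K_contact xi g <-> (forall V W W', cov_metric nt g V W W' = 0).
Proof.
split=> [K V W W'|m V W]; first by rewrite adapted_cov_metric K mulr0.
by have := adapted_cov_metric xi V W; rewrite m eta_xi mul1r => /esym.
Qed.

Notation B := (cov_endo nt phi).

Lemma cov_phi_reeb V : B V xi = 0.
Proof.
by rewrite /cov_endo (phi_reeb Hcm) nt_xi linear0 (conn0r c) subrr.
Qed.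

Lemma cov_phi_horizontal V W : horizontal eta (B V W).
Proof.
rewrite /horizontal /cov_endo oneformD oneformN nt_eta !(eta_phi Hcm).
by rewrite vderiv0 subrr.
Qed.

(** [phi] is [g]-skew and [g] is parallel in horizontal directions, so the
    derivative of [phi] is again skew. *)
Lemma cov_phi_skew X Y Z : horizontal eta X -> g (B X Y) Z = - g Y (B X Z).
Proof.
move=> HX; apply/eqP; rewrite -addr_eq0; apply/eqP.
transitivity (- (cov_metric nt g X (phi Y) Z + cov_metric nt g X Y (phi Z))).
  rewrite /cov_metric /cov_endo !(metricDl Hg) !(metricDr Hg) !(metricNl Hg).
  by rewrite !(metricNr Hg) !(metric_phi_skew Hcm) vderivN; ring.
by rewrite !adapted_cov_metric HX !mul0r addr0 oppr0.
Qed.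

(** Replacing each bracket by the connection minus its torsion, only the bracket
    of [phi V] and [phi W] contributes a torsion term, because [phi xi = 0]; it
    cancels [2 d eta (x) xi], because [d eta] is [phi]-invariant. *)
Lemma nijenhuis_adapted V W :
  nijenhuis phi V W + (2 * dform eta V W) *: xi =
  B (phi V) W - B (phi W) V - phi (B V W) + phi (B W V).
Proof.
have lie_nt X Y : [' X, Y] = nt X Y - nt Y X - (2 * dform eta X Y) *: xi.
  rewrite (adapted_lie X Y Hnt).
  by move: (nt _ _) [' X, Y] => U U'; vfield_ring.
have phi_lie X Y : phi [' X, Y] = phi (nt X Y) - phi (nt Y X).
  by rewrite lie_nt !linearB linearZ /= (phi_reeb Hcm) scaler0 subr0.
rewrite /nijenhuis !phi_lie lie_nt (dform_phi Hcm) /cov_endo !linearB /=.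
vfield_ring.
Qed.

(** With [F X Y Z = g (B X Y) Z = - (nabla_X d eta) (Y, Z)] on horizontal
    fields, this is once more [d (d eta) = 0]. *)
Lemma cov_phi_cyclic X Y Z :
  horizontal eta X -> horizontal eta Y -> horizontal eta Z ->
  g (B X Y) Z + g (B Y Z) X + g (B Z X) Y = 0.
Proof.
move=> HX HY HZ.
have F U V W : horizontal eta U -> g (B U V) W =
    dform eta (nt U V) W - dform eta (nt U W) V - U (dform eta V W) :> Cinf M.
  move=> HU; have := adapted_cov_metric U (phi V) W.
  rewrite HU mul0r /cov_metric => /eqP; rewrite subr_eq0 => /eqP E.
  rewrite (dformC eta (nt U W)) !compat opprK.
  rewrite /cov_endo (metricDl Hg) (metricNl Hg) (metric_phi_skew Hcm) opprK.
  have -> : g V (phi W) = - g (phi V) W by rewrite (metric_phi_skew Hcm) opprK.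
  have -> : g V (phi (nt U W)) = - g (phi V) (nt U W).
    by rewrite (metric_phi_skew Hcm) opprK.
  by rewrite vderivN -E; ring.
have closed := dform_closed eta X Y Z.
rewrite !F //.
have lie_nt U V W : dform eta [' U, V] W =
    dform eta (nt U V) W - dform eta (nt V U) W.
  rewrite (adapted_lie U V Hnt) !(dformDl Hcm) !compat (metricZl Hg).
  by rewrite -(compat xi) (reeb_deta Hcm) mulr0 addr0 addrC addKr.
rewrite !lie_nt in closed.
move/eqP: closed; rewrite -subr_eq0 -oppr_eq0 => /eqP <-; ring.
Qed.

(** A horizontal field is [- phi] of a horizontal field, so it is enough that
    [G X Y Z = g (B (phi X) Y) Z] vanishes.  Combined with the cyclic identity,
    normality reads [G X Y Z + G Y Z X = G Z X Y], and adding the same relation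
    after a cyclic shift leaves [2 G X Y Z = 0]. *)
Lemma sasakian_cov_phi :
  sasakian eta xi phi <-> (forall V W, B V W = 0).
Proof.
split=> [S V W|B0 V W]; last first.
  by rewrite nijenhuis_adapted !B0 (linear0 phi) !subr0 addr0.
have N X Y : B (phi X) Y - B (phi Y) X - phi (B X Y) + phi (B Y X) = 0.
  by rewrite -nijenhuis_adapted S.
have B_xi Y : B xi Y = 0.
  apply: (phi_inj_horizontal Hcm); first exact: cov_phi_horizontal.
  have := N xi Y.
  rewrite (phi_reeb Hcm) !cov_phi_reeb (linear0 phi) subr0 addr0.
  have -> : B 0 Y = 0 by rewrite /cov_endo !(conn0l c) (linear0 phi) subrr.
  by rewrite sub0r => /eqP; rewrite oppr_eq0 => /eqP.
pose G X Y Z := g (B (phi X) Y) Z.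
have Hphi X : horizontal eta (phi X) := eta_phi Hcm X.
have G_cyc X Y Z : horizontal eta X -> horizontal eta Y -> horizontal eta Z ->
    G X Y Z + G Y Z X = G Z X Y.
  move=> HX HY HZ; have := congr1 (g^~ Z) (N X Y).
  rewrite (metric0l Hg) (metricDl Hg _ (phi (B Y X))).
  rewrite (metricDl Hg _ (- phi (B X Y))) (metricDl Hg _ (- B (phi Y) X)).
  rewrite !(metricNl Hg) (metric_phi_skew Hcm (B X Y)).
  rewrite (metric_phi_skew Hcm (B Y X)) (cov_phi_skew _ _ (Hphi Y)).
  rewrite (metricC Hg X) -/(G X Y Z) -/(G Y Z X).
  have := cov_phi_cyclic HX HY (Hphi Z); rewrite -/(G Z X Y).
  rewrite (cov_phi_skew _ _ HY) (metricC Hg (phi Z)) => E1 E2.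
  apply/eqP; rewrite -subr_eq0 -[X in _ == X]E2; apply/eqP.
  rewrite -[LHS]addr0 -E1; ring.
have G0 X Y Z : horizontal eta X -> horizontal eta Y -> horizontal eta Z ->
    G X Y Z = 0.
  move=> HX HY HZ; apply: two_mul_inj.
  rewrite mulr0; have := G_cyc Z X Y HZ HX HY.
  by rewrite -(G_cyc X Y Z) // => /eqP; rewrite -subr_eq0 => /eqP <-; ring.
have B_hor X Y : horizontal eta X -> horizontal eta Y -> B X Y = 0.
  move=> HX HY; apply: (metric_definite Hg).
  have -> : B X Y = B (phi (- phi X)) Y.
    by rewrite linearN /= (contact_metric_phi2 Hcm) HX scale0r addr0 opprK.
  apply: G0 => //; last exact: cov_phi_horizontal.
  by rewrite /horizontal oneformN Hphi oppr0.
rewrite (splitD eta xi V) (splitD eta xi W) ![_ + _ *: xi]addrC.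
rewrite (cov_endo_linear_r c) cov_phi_reeb (cov_endo_linear_l c) B_xi.
rewrite !scaler0 !add0r.
by rewrite B_hor //; exact: projD_horizontal.
Qed.

Lemma sasakian_lie_endo V : sasakian eta xi phi -> lie_endo xi phi V = 0.
Proof.
by move=> /sasakian_cov_phi B0; rewrite -(B0 xi V) /cov_endo !nt_reeb.
Qed.

(** [g] is built from [d eta], [phi] and [eta], all invariant under the flow of
    [xi]. *)
Lemma sasakian_K_contact : sasakian eta xi phi -> K_contact xi g.
Proof.
move=> S V W; rewrite /lie_metric !(metric_dform Hcm) !(eta_lie_reeb Hcm).
have <- : [' xi, phi W] = phi [' xi, W].
  by apply/eqP; rewrite -subr_eq0; apply/eqP/sasakian_lie_endo.
by rewrite vderivD vderivN (vderivM _ (eta V)) (dform_lie_reeb Hcm); ring.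
Qed.

End Fixed.

(** For a Levi-Civita connection, [g (nabla V xi) W] always has skew part
    [d eta V W]; when [xi] is Killing it has no symmetric part. *)
Lemma K_contact_nabla_reeb nabla V : levi_civita g nabla -> K_contact xi g ->
  nabla V xi = - phi V.
Proof.
move=> [Hn Ht Hm] K; apply/eqP; rewrite -subr_eq0 opprK; apply/eqP.
apply: (metric_nondegenerate Hg) => W.
have lie_nabla X Y : [' X, Y] = nabla X Y - nabla Y X.
  by apply/eqP; rewrite eq_sym -subr_eq0; apply/eqP/Ht.
have compat_nabla X Y Z :
    X (g Y Z) = g (nabla X Y) Z + g Y (nabla X Z) :> Cinf M.
  by apply/eqP; rewrite -subr_eq0 opprD addrA; apply/eqP/Hm.
have skew : g (nabla V xi) W + g (nabla W xi) V = 0.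
  have := K V W; rewrite /lie_metric compat_nabla !lie_nabla.
  rewrite !(metricDl Hg) !(metricDr Hg) !(metricNl Hg) !(metricNr Hg).
  by rewrite (metricC Hg V (nabla W xi)) => <-; ring.
rewrite (metricDl Hg) (metric_phi_skew Hcm) -compat.
apply: two_mul_inj; rewrite mulr0 mulrDr mulrN double_dform lie_nabla.
rewrite -!g_xi !compat_nabla (metricDl Hg) (metricNl Hg).
rewrite (metricC Hg W) (metricC Hg V (nabla W xi)).
by rewrite -[RHS]skew; ring.
Qed.

Lemma tanaka_webster_tilde nabla : levi_civita g nabla -> K_contact xi g ->
  (forall V, lie_endo xi phi V = 0) ->
  connection (tanaka_webster eta xi phi nabla) /\
  tilde_equations eta xi nabla (tanaka_webster eta xi phi nabla).
Proof.
move=> Hlc K L; have [Hn Ht Hm] := Hlc.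
have TW V W : tanaka_webster eta xi phi nabla V W =
    nabla V W + eta V *: phi W + eta W *: phi V + dform eta V W *: xi.
  rewrite /tanaka_webster; have -> : h_tensor xi phi V = 0.
    by rewrite /h_tensor L scaler0.
  by rewrite (linear0 phi) !addr0.
have nabla_xi V := K_contact_nabla_reeb V Hlc K.
split; first split=> [W a V V'|V W W'|V f W]; rewrite ?TW.
- rewrite (connDl Hn) (connZl Hn) oneformD oneformZ (linearD phi).
  rewrite (linearZ_LR phi) !compat (metricDl Hg) (metricZl Hg) /=.
  by move: (nabla _ _) (nabla _ _) (phi _) (phi _) (phi _) => *; vfield_ring.
- rewrite (connDr Hn) oneformD (linearD phi) !compat (linearD phi).
  rewrite (metricDr Hg).
  by move: (nabla _ _) (nabla _ _) (phi _) (phi _) (phi _) => *; vfield_ring.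
- rewrite (connZr Hn) oneformZ !compat (linearZ_LR phi) (metricZr Hg) /=.
  by move: (nabla _ _) (phi _) (phi _) => *; vfield_ring.
split=> [Z Z' HZ HZ'|Z HZ|V]; rewrite TW.
- rewrite HZ HZ' !scale0r !addr0 /projD; congr (_ + _).
  have := Hm Z Z' xi; rewrite /cov_metric !g_xi HZ' vderiv0 nabla_xi.
  rewrite (metricNr Hg) opprK sub0r -compat (dformC eta Z') => /eqP.
  by rewrite subr_eq0 => /eqP <-; rewrite scaleNr.
- rewrite eta_xi HZ scale0r scale1r (reeb_deta Hcm) scale0r !addr0.
  rewrite -[phi Z]opprK -nabla_xi.
  by apply/esym/eqP; rewrite eq_sym -subr_eq0; apply/eqP/Ht.
- rewrite (phi_reeb Hcm) eta_xi scaler0 scale1r addr0 dformC (reeb_deta Hcm).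
  by rewrite oppr0 scale0r addr0 nabla_xi addNr.
Qed.

End Adapted.

(** * The characterisation theorem *)

Theorem theorem4p3 (R : realType) (n : nat) (M : manifold R n.*2.+1)
    (eta : {scalar vfield M}) (xi : vfield M)
    (phi : {linear vfield M -> vfield M})
    (g : vfield M -> vfield M -> Cinf M)
    (nabla : vfield M -> vfield M -> vfield M)
    (Hcm : contact_metric eta xi phi g) (Hlc : levi_civita g nabla) :
  (exists! nt, connection nt /\ tilde_equations eta xi nabla nt) /\
  forall nt : vfield M -> vfield M -> vfield M,
    connection nt -> tilde_equations eta xi nabla nt ->
    [/\ unique (fun nt' => [/\ connection nt', preserves_D eta nt' &
                               tilde_properties eta xi g nt']) nt,
        K_contact xi g <-> (forall V W W', cov_metric nt g V W W' = 0),
        sasakian eta xi phi <-> (forall V W, cov_endo nt phi V W = 0) &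
        sasakian eta xi phi -> nt = tanaka_webster eta xi phi nabla].
Proof.
have eta_xi := reeb_eta Hcm; have [Hn _ _] := Hlc.
split.
  exists (tilde_connection eta xi nabla); split=> [|nt [c e]].
    split; first exact: tilde_connection_connection.
    exact: tilde_connection_equations.
  apply: (tilde_equations_unique eta_xi _ _ c e).
    exact: tilde_connection_connection.
  exact: tilde_connection_equations.
move=> nt c e; have Hnt := tilde_equations_adapted Hcm Hlc c e.
split.
- by split=> // nt' Hnt'; exact: (adapted_unique Hcm Hnt Hnt').
- exact: (adapted_K_contact Hcm Hnt).
- exact: (sasakian_cov_phi Hcm Hnt).
- move=> S; have [c' e'] := tanaka_webster_tilde Hcm Hlc
    (sasakian_K_contact Hcm Hnt S) (fun V => sasakian_lie_endo Hcm Hnt V S).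
  exact: (tilde_equations_unique eta_xi c e c' e').
Qed.
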